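(* Let $k\ge 2$ be an integer and let $n\ge 3k+5$ be an integer. Then there is a graph $G$ on $n$ vertices with minimum degree $\delta(G)\ge (n-3k-4)/2$ for which $\mathcal{H}_G$ is not $k$-switch irreducible.
   Context: Graphs are finite, simple and undirected. $\mathcal{H}_G$ is the set of all Hamiltonian cycles of $G$, viewed as spanning subgraphs. A switch of size $j$ transforms some $H\in\mathcal{H}_G$ into some $H'\in\mathcal{H}_G$ by removing exactly $j$ edges of $H$ and adding exactly $j$ edges not in $H$; a $k$-switch is a switch of size at most $k$. $\mathcal{H}_G$ is $k$-switch irreducible if for all $H_1,H_2\in\mathcal{H}_G$ there is a sequence $H_1=Z_1,\dots,Z_q=H_2$ of elements of $\mathcal{H}_G$ such that every consecutive pair $(Z_i,Z_{i+1})$ differs by a $k$-switch. *)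

(* Defs.v *)
From HB Require Import structures.
From mathcomp Require Import all_boot all_order all_algebra.
Set Implicit Arguments. Unset Strict Implicit. Unset Printing Implicit Defensive.

Record sgraph := SGraph {
  svertex :> finType;
  sedge : rel svertex;
  sedge_sym : symmetric sedge;
  sedge_irrefl : irreflexive sedge
}.

Definition degree (G : sgraph) (x : G) : nat := #|[set y : G | sedge x y]|.

(* The default value #|G| exceeds every degree, so this is the minimum of the
   degrees as soon as G has a vertex. *)
Definition min_degree (G : sgraph) : nat :=
  \big[minn/#|G|]_(x : G) degree x.

(* A spanning subgraph is represented by its edge set, a set of two-element
   sets of vertices. *)
Definition cycle_edges (T : finType) (c : seq T) : {set {set T}} :=
  [set [set x; next c x] | x in c].

(* Each Hamiltonian cycle comes from all of its cyclic enumerations; those with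
   the same edge set are identified. *)
Definition ham_cycles (G : sgraph) : {set {set {set G}}} :=
  [set cycle_edges c | c : #|G|.-tuple G
                     & [&& 2 < #|G|, uniq c & cycle (@sedge G) c]].

Definition switch (T : finType) (j : nat) (H H' : {set {set T}}) : bool :=
  [exists R : {set {set T}}, exists A : {set {set T}},
    [&& R \subset H, #|R| == j, [disjoint A & H], #|A| == j
      & H' == (H :\: R) :|: A]].

Definition kswitch (T : finType) (k : nat) (H H' : {set {set T}}) : bool :=
  [exists j : 'I_k.+1, switch j H H'].

(* The sequence Z_1, ..., Z_q is H1 :: Z. *)
Definition switch_irreducible (k : nat) (G : sgraph) : Prop :=
  forall H1 H2 : {set {set G}}, H1 \in ham_cycles G -> H2 \in ham_cycles G ->
  exists Z : seq {set {set G}},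
    [/\ {subset Z <= ham_cycles G}, path (kswitch k) H1 Z & last H1 Z = H2].

(* Main.v *)
Require Import Defs.
From HB Require Import structures.
From mathcomp Require Import all_boot all_order all_algebra.
From mathcomp Require Import zify lra.
Set Implicit Arguments. Unset Strict Implicit. Unset Printing Implicit Defensive.
Import Order.TTheory GRing.Theory Num.Theory.
Local Open Scope nat_scope.

(** The graph is built so that its Hamiltonian cycles fall into two classes that
are more than [k] edges apart.  Put [m = k + 1].

The heart is a graph F on the vertices [0 .. N-1]: the path through them in
this order, together with the image of that path under an involution, [mirror].
F is a ladder.  Row [i], for [0 < i < m], is the path [3i-1, 3i, 3i+1], and
[mirror] exchanges its two ends.  The path and its mirror image are the two
zigzags through the ladder: they share the rows and use complementary edges
between the rows.  The vertices [1] and [3m-1] close the ladder at its two ends,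
[0] is pendant at [1], and the path [3m .. N-1] hangs at [3m-1].

To F are added [r+1] apex vertices and [r] isolated vertices, in alternation;
then apexes are joined to all vertices that are not apexes, and to nothing else.
A Hamiltonian cycle has [2(r+1)] edges at the apexes.  Each isolated vertex
consumes two of these, each of [0] and [N-1], having degree one in F, at least
one, and this uses all of them up ([saturated]).  Hence every other vertex of F
has both of its cycle edges in F, and the cycle traces a Hamiltonian path of F.

The middles [3i] of the rows have degree two in F, so both of their edges are
used.  What is left of the ladder is a cycle of length [2m] at each of whose
vertices one edge is already forced; exactly one of the two edges of this
2m-cycle is therefore used at each of its vertices, and a Hamiltonian cycle
contains either all [m] rails [{3i+1, 3i+2}] or none of them
([rails_dichotomy]).  Both cases occur, for the enumeration [0, 1, .., n-1] and
for its mirror image.  A switch from one class to the other would remove all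
rails at once, which are [m > k] edges ([switch_rails]). *)

(** * Edges of a cyclic enumeration *)

Lemma set2_eqP (T : finType) (a b x y : T) :
  [set a; b] = [set x; y] -> a = x /\ b = y \/ a = y /\ b = x.
Proof.
move=> E.
have: a \in [set x; y] by rewrite -E !inE eqxx.
have: b \in [set x; y] by rewrite -E !inE eqxx orbT.
have: x \in [set a; b] by rewrite E !inE eqxx.
have: y \in [set a; b] by rewrite E !inE eqxx orbT.
rewrite !inE.
by do 4! case/orP => /eqP ?; subst; auto.
Qed.

(** On three or more vertices the two neighbours of a vertex differ; on two
vertices the enumeration would trace the same edge twice. *)
Lemma next2_neq (T : eqType) (c : seq T) (x : T) :
  uniq c -> 2 < size c -> x \in c -> next c (next c x) != x.
Proof.
move=> Uc sz_c /rot_to[i s Ec].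
have Us : uniq (x :: s) by rewrite -Ec rot_uniq.
have Sz : 2 < size (x :: s) by rewrite -Ec size_rot.
rewrite -!(next_rot i Uc) Ec.
case: s Us Sz {Ec} => [|y [|z s]] //= /and4P[].
rewrite !inE !negb_or eqxx => /and3P[xy xz _] _ _ _ _.
by rewrite eqxx ![_ == x]eq_sym (negPf xy).
Qed.

Lemma mem_cycle_edges (T : finType) (c : seq T) (x y : T) :
  uniq c -> (forall z, z \in c) ->
  ([set x; y] \in cycle_edges c) = (y == next c x) || (y == prev c x).
Proof.
move=> Uc Tc; apply/imsetP/orP => [[z _ /set2_eqP[[-> ->]|[-> ->]]]|].
- by left.
- by right; rewrite prev_next.
case=> /eqP ->; first by exists x.
by exists (prev c x); rewrite // next_prev // setUC.
Qed.

Lemma nth_cycle_edges (T : finType) (x0 : T) (c : seq T) (i : nat) :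
  uniq c -> i.+1 < size c -> [set nth x0 c i; nth x0 c i.+1] \in cycle_edges c.
Proof.
move=> Uc lt_i; apply/imsetP; exists (nth x0 c i); first exact/mem_nth/ltnW.
rewrite next_nth mem_nth ?index_uniq ?(ltnW lt_i) //.
case: c Uc lt_i => //= y c _ lt_i.
by rewrite (set_nth_default x0).
Qed.

(** * The graph *)

Section Graph.
(* [m] is the number of rails, [N] the number of vertices of the ladder with its
   pendant paths, and [r] the number of vertices adjacent to apexes only. *)
Variables m N r : nat.

Let n := (N + r.*2).+1.

Definition apex (v : nat) : bool := (N <= v) && ~~ odd (v - N).

(** The reflection of the ladder: [3i-1] and [3i+1] are exchanged, [0 < i < m]. *)
Definition mirror (v : nat) : nat :=
  if (1 < v) && (v < 3 * m - 1) then
    if v %% 3 == 2 then v + 2 else if v %% 3 == 1 then v - 2 else v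
  else v.

Definition consecutive (u v : nat) : bool := (v == u.+1) || (u == v.+1).

(** The union of the path [0, 1, 2, ..] with its mirror image. *)
Definition gadget (u v : nat) : bool :=
  consecutive u v || consecutive (mirror u) (mirror v).

Definition adjacent (u v : nat) : bool :=
  (apex u (+) apex v) || [&& u < N, v < N & gadget u v].

Lemma adjacentC (u v : nat) : adjacent u v = adjacent v u.
Proof. rewrite /adjacent /gadget /consecutive addbC; lia. Qed.

Lemma adjacent_irr (u : nat) : adjacent u u = false.
Proof. rewrite /adjacent /gadget /consecutive addbb; lia. Qed.

Definition graph : sgraph :=
  @SGraph 'I_n (fun u v => adjacent u v)
    (fun u v => adjacentC u v) (fun u => adjacent_irr u).

Let V (i : nat) : 'I_n := inord i.

Lemma V_K (i : nat) : i < n -> V i = i :> nat.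
Proof. by move=> lt_i; rewrite inordK. Qed.

Hypotheses (m_gt1 : 1 < m) (N_gt : 3 * m < N).

Lemma ltN_n (i : nat) : i < N -> i < n.
Proof. by rewrite /n; lia. Qed.

(** A description of [mirror] in a form that linear arithmetic can consume. *)
Lemma mirrorE (v : nat) :
  ~~ (1 < v < 3 * m - 1) /\ mirror v = v \/
  1 < v < 3 * m - 1 /\
  (v %% 3 = 2 /\ mirror v = v + 2 \/ v %% 3 = 1 /\ mirror v = v - 2
   \/ v %% 3 = 0 /\ mirror v = v).
Proof.
rewrite /mirror; case: ifP => h; last by left.
by right; split=> //; do ! case: ifP => ?; lia.
Qed.

Lemma mirrorK (v : nat) : mirror (mirror v) = v.
Proof. by have := mirrorE (mirror v); have := mirrorE v; lia. Qed.

Lemma mirror_lt (b v : nat) : 3 * m - 1 <= b -> (mirror v < b) = (v < b).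
Proof. by have := mirrorE v; lia. Qed.

Lemma apex_mirror (v : nat) : apex (mirror v) = apex v.
Proof. by rewrite /apex; have := mirrorE v; lia. Qed.

Lemma mirror_hub (i : nat) : mirror (3 * i) = 3 * i.
Proof. by have := mirrorE (3 * i); lia. Qed.

Lemma mirror_left (i : nat) : i.+1 < m -> mirror (3 * i + 2) = 3 * i + 4.
Proof. by have := mirrorE (3 * i + 2); lia. Qed.

Lemma mirror_right (i : nat) : i.+1 < m -> mirror (3 * i + 4) = 3 * i + 2.
Proof. by move=> lt_i; rewrite -mirror_left // mirrorK. Qed.

Lemma mirror_fix (v : nat) : (v <= 1) || (3 * m - 1 <= v) -> mirror v = v.
Proof. by have := mirrorE v; lia. Qed.

Lemma mirror_le (i : nat) : mirror (3 * i + 1) <= 3 * i + 1.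
Proof. by have := mirrorE (3 * i + 1); lia. Qed.

Lemma mirror_ge (i : nat) : 3 * i + 2 <= mirror (3 * i + 2).
Proof. by have := mirrorE (3 * i + 2); lia. Qed.

Lemma gadget_neighbour (u w : nat) : gadget u w ->
  w = u.-1 \/ w = u.+1 \/ w = mirror (mirror u).-1 \/ w = mirror (mirror u).+1.
Proof.
case/orP => /orP[] /eqP.
- by auto.
- by move->; auto.
- by move=> <-; rewrite mirrorK; auto.
- by move->; rewrite /= mirrorK; auto.
Qed.

(** The reflection is an automorphism, so it carries Hamiltonian cycles to
Hamiltonian cycles. *)
Lemma adjacent_mirror (u v : nat) :
  adjacent (mirror u) (mirror v) = adjacent u v.
Proof.
by rewrite /adjacent !apex_mirror !mirror_lt /gadget ?mirrorK 1?orbC //; lia.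
Qed.

(** * Degrees *)

Lemma sum_apex : \sum_(v < n) apex v = r.+1.
Proof.
rewrite -(big_mkord xpredT (fun v => apex v : nat)) /n.
elim: r => [|s IHs].
  rewrite double0 addn0 big_nat_recr //= big1_seq => [|i].
    by rewrite /apex; lia.
  by rewrite mem_index_iota /apex; lia.
by rewrite doubleS !addnS big_nat_recr // big_nat_recr // IHs /= /apex; lia.
Qed.

Lemma card_apex : #|[set v : 'I_n | apex v]| = r.+1.
Proof. by rewrite -sum_apex -sum1dep_card big_mkcond. Qed.

(** A vertex that is not an apex sees all [r+1] apexes, and an apex sees all
vertices that are not, of which there are at least as many. *)
Lemma min_degree_graph : r.+1 <= min_degree graph.
Proof.
rewrite /min_degree; elim/big_ind: _ => [|x y hx hy|v _].
- by rewrite card_ord; lia.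
- by rewrite leq_min hx.
rewrite /degree; have [av|nav] := boolP (apex v).
  apply: (@leq_trans #|~: [set v : 'I_n | apex v]|).
    by have := cardsC [set v : 'I_n | apex v]; rewrite card_apex card_ord /n; lia.
  apply/subset_leq_card/subsetP => u; rewrite !inE /= /adjacent.
  by rewrite av => /negPf->.
rewrite -card_apex; apply/subset_leq_card/subsetP => u; rewrite !inE /= /adjacent.
by rewrite (negPf nav) => ->.
Qed.

(** * Forced edges of Hamiltonian cycles *)

(** The number of apexes that a Hamiltonian cycle must put next to [v]: both
neighbours for a vertex adjacent to apexes only, and one for each end of the
path [0 .. N-1]. *)
Definition demand (v : nat) : nat :=
  2 * ((N <= v) && odd (v - N)) + (v == 0) + (v == N.-1).

Lemma sum_demand : \sum_(v < n) demand v = 2 * r.+1.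
Proof.
rewrite -(big_mkord xpredT demand) /n.
elim: r => [|s IHs]; last first.
  by rewrite doubleS !addnS big_nat_recr // big_nat_recr // IHs /demand /=; lia.
rewrite double0 addn0 big_nat_recr //.
have [N' EN] : exists N', N = N'.+2 by exists N.-2; lia.
rewrite EN big_nat_recr // big_nat_recl //= big1_seq => [|i].
  by rewrite /demand; lia.
by rewrite mem_index_iota /demand; lia.
Qed.

Section HamiltonianCycle.
Variable c : seq 'I_n.
Hypotheses (Uc : uniq c) (sz_c : size c = n).
Hypothesis cycle_c : cycle (@sedge graph) c.

Lemma spanning (v : 'I_n) : v \in c.
Proof.
have sub_c : {subset c <= enum 'I_n} by move=> u _; rewrite mem_enum.
have [|_ ->] := uniq_min_size Uc sub_c; last by rewrite mem_enum.
by rewrite sz_c size_enum_ord.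
Qed.

Lemma adjacent_next (v : 'I_n) : adjacent v (next c v).
Proof. exact: (next_cycle cycle_c (spanning v)). Qed.

Lemma adjacent_prev (v : 'I_n) : adjacent v (prev c v).
Proof. by rewrite adjacentC; apply: (prev_cycle cycle_c (spanning v)). Qed.

Lemma next_neq_prev (v : 'I_n) : next c v != prev c v.
Proof.
have := next2_neq (x := prev c v) Uc _ (spanning _).
by rewrite next_prev //; apply; rewrite sz_c /n; lia.
Qed.

Lemma nonapex_edge (v w : nat) :
  adjacent v w -> ~~ apex v -> ~~ apex w -> w < N /\ gadget v w.
Proof.
by move=> A_vw /negPf nv /negPf nw; move: A_vw; rewrite /adjacent nv nw => /and3P[].
Qed.

Lemma gadget_start (w : nat) : gadget 0 w -> w = 1.
Proof.
by rewrite /gadget /consecutive; have := mirrorE 0; have := mirrorE w; lia.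
Qed.

Lemma gadget_end (w : nat) : w < N -> gadget N.-1 w -> w = N.-2.
Proof.
by rewrite /gadget /consecutive; have := mirrorE N.-1; have := mirrorE w; lia.
Qed.

(** An end of the path has a single neighbour that is not an apex, while its two
neighbours on the cycle are distinct. *)
Lemma demand_le (v : 'I_n) : demand v <= apex (next c v) + apex (prev c v).
Proof.
have An := adjacent_next v; have Ap := adjacent_prev v.
have ne := next_neq_prev v; rewrite -val_eqE /= in ne.
have [/andP[leNv odd_v]|iso] := boolP ((N <= v) && odd (v - N)).
  have : ~~ apex v by rewrite /apex; lia.
  move: An Ap; rewrite /adjacent ltnNge leNv /= !orbF => An Ap /negPf av.
  by move: An Ap; rewrite av /= /demand => -> ->; lia.
case: (boolP ((v == 0 :> nat) || (v == N.-1 :> nat))) => [ends|]; last first.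
  by rewrite /demand; lia.
have av : ~~ apex v by rewrite /apex; lia.
have uniq_nbr w1 w2 : w1 < N /\ gadget v w1 -> w2 < N /\ gadget v w2 -> w1 = w2.
  case/orP: ends => /eqP ->.
    by move=> [_ /gadget_start ->] [_ /gadget_start ->].
  by move=> [h1 /(gadget_end h1) ->] [h2 /(gadget_end h2) ->].
have : apex (next c v) || apex (prev c v).
  apply: contraNT ne; rewrite negb_or => /andP[an ap].
  by apply/eqP/uniq_nbr; apply: nonapex_edge.
by rewrite /demand; lia.
Qed.

(** Both sides have the same sum over all vertices: apexes are pairwise not
adjacent, and [next] and [prev] are bijections, so apexes occur [2(r+1)] times
as a neighbour, which is the total demand.  The pointwise inequality is thus an
equality. *)
Lemma saturated (v : 'I_n) : apex (next c v) + apex (prev c v) = demand v.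
Proof.
have le_v (u : 'I_n) : true -> demand u <= apex (next c u) + apex (prev c u)
    ?= iff (demand u == apex (next c u) + apex (prev c u)).
  by move=> _; split=> //; apply: demand_le.
have [_] := leqif_sum le_v.
rewrite sum_demand big_split /=; pose degA (u : 'I_n) : nat := apex u.
rewrite -(reindex_inj (h := next c) (P := xpredT) (F := degA)) /=;
  last exact: can_inj (prev_next Uc).
rewrite -(reindex_inj (h := prev c) (P := xpredT) (F := degA)) /=;
  last exact: can_inj (next_prev Uc).
by rewrite sum_apex addnn mul2n eqxx => /esym/forallP/(_ v)/eqP.
Qed.

Definition used (i j : nat) : bool := [set V i; V j] \in cycle_edges c.

Lemma usedC (i j : nat) : used i j = used j i.
Proof. by rewrite /used setUC. Qed.

Lemma usedE (u w : nat) : w < n ->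
  used u w = (w == next c (V u) :> nat) || (w == prev c (V u) :> nat).
Proof.
move=> lt_w; rewrite /used mem_cycle_edges //; last exact: spanning.
by rewrite -!(inj_eq val_inj) /= V_K.
Qed.

(** Inner vertices have no demand, so both of their cycle edges are in the
ladder part. *)
Lemma inner_neighbours (u : nat) : 0 < u < N.-1 ->
  exists x y : nat, [/\ x != y, x < N /\ gadget u x, y < N /\ gadget u y
    & forall w, w < n -> used u w = (w == x) || (w == y)].
Proof.
move=> u_in; have lt_u : u < n by rewrite /n; lia.
have sat := saturated (V u).
have An := adjacent_next (V u); have Ap := adjacent_prev (V u).
rewrite V_K // in An Ap sat.
exists (next c (V u)), (prev c (V u)); split.
- by have := next_neq_prev (V u); rewrite -val_eqE.
- by apply: nonapex_edge => //; move: sat; rewrite /demand /apex; lia.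
- by apply: nonapex_edge => //; move: sat; rewrite /demand /apex; lia.
- exact: usedE.
Qed.

Lemma used_both (u a b : nat) : 0 < u < N.-1 -> a < N -> b < N ->
  (forall w, w < N -> gadget u w -> w = a \/ w = b) -> used u a && used u b.
Proof.
move=> u_in lt_a lt_b nbr.
have [x [y [ne [lx gx] [ly gy] E]]] := inner_neighbours u_in.
have := nbr _ lx gx; have := nbr _ ly gy.
by rewrite !E ?ltN_n //; lia.
Qed.

(** A cycle uses two of the three edges of the ladder part at [u]; one of them is
known, so exactly one of the two others is used. *)
Lemma used_either (u p a b : nat) :
    0 < u < N.-1 -> p < N -> a < N -> b < N ->
    [&& p != a, p != b & a != b] -> used u p ->
  (forall w, w < N -> gadget u w -> w = p \/ w = a \/ w = b) ->
  used u a = ~~ used u b.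
Proof.
move=> u_in lt_p lt_a lt_b ne_pab.
have [x [y [ne [lx gx] [ly gy] E]]] := inner_neighbours u_in.
rewrite !E ?ltN_n //.
move=> hp nbr; move: (nbr _ lx gx) (nbr _ ly gy) ne ne_pab.
by case/orP: hp => /eqP <-; clear=> hx hy ne ne_pab; lia.
Qed.

(** The pendant vertex [0] has just one apex next to it. *)
Lemma used_start : used 0 1.
Proof.
have sat := saturated (V 0).
have An := adjacent_next (V 0); have Ap := adjacent_prev (V 0).
rewrite V_K // in An Ap sat; rewrite usedE; last by rewrite /n; lia.
have nu : ~~ apex 0 by rewrite /apex; lia.
have [nn|] := boolP (apex (next c (V 0))); last first.
  by move=> /(nonapex_edge An nu)[_ /gadget_start ->].
have /(nonapex_edge Ap nu)[_ /gadget_start ->] : ~~ apex (prev c (V 0)).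
  by move: sat; rewrite nn /demand; lia.
by rewrite orbT.
Qed.

Lemma used_hub (i : nat) : i.+1 < m ->
  used (3 * i + 3) (3 * i + 2) && used (3 * i + 3) (3 * i + 4).
Proof.
move=> lt_i; apply: used_both; try lia.
have Eu : mirror (3 * i + 3) = 3 * i + 3 by rewrite -mulnSr mirror_hub.
have Ep : (3 * i + 3).-1 = 3 * i + 2 by lia.
have Es : (3 * i + 3).+1 = 3 * i + 4 by lia.
move=> w _ /gadget_neighbour; rewrite Eu Ep Es mirror_left // mirror_right //.
by clear; lia.
Qed.

(** The rails of the path [0, 1, 2, ..] and those of its mirror image; together
they form the cycle of length [2m] left when the edges of the rows and of the
pendant paths are removed. *)
Definition straight (i : nat) : bool := used (3 * i + 1) (3 * i + 2).

Definition crossed (i : nat) : bool :=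
  used (mirror (3 * i + 1)) (mirror (3 * i + 2)).

(** The three lemmas below compare the two edges of the 2m-cycle at the vertices
[1], [3i+4] and [3i+2]; the third edge there is forced, by the pendant vertex
[0] or by the middle [3i+3] of the row. *)
Lemma straight0 : straight 0 = ~~ crossed 0.
Proof.
rewrite /straight /crossed mirror_left // mirror_fix // muln0 !add0n.
apply: (@used_either _ 0); try lia.
  by rewrite usedC used_start.
move=> w _ /gadget_neighbour; rewrite (mirror_fix (v := 1)) //= mirror_fix //.
by rewrite (mirror_left (i := 0)) //; clear; lia.
Qed.

Lemma straightS (i : nat) : i.+1 < m -> straight i.+1 = ~~ crossed i.
Proof.
have [E1 E2] : 3 * i.+1 + 1 = 3 * i + 4 /\ 3 * i.+1 + 2 = 3 * i + 5 by lia.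
move=> lt_i; rewrite /straight /crossed mirror_left // [in RHS]usedC E1 E2.
have ge_b := mirror_le i.
apply: (@used_either _ (3 * i + 3)); try lia.
  by rewrite usedC; have /andP[] := used_hub lt_i.
have Ep : (3 * i + 2).-1 = 3 * i + 1 by lia.
have Es : (3 * i + 2).+1 = 3 * i.+1 by lia.
move=> w _ /gadget_neighbour; rewrite mirror_right // Ep Es mirror_hub.
by clear; lia.
Qed.

Lemma crossedS (i : nat) : i.+1 < m -> crossed i.+1 = ~~ straight i.
Proof.
have [E1 E2] : 3 * i.+1 + 1 = 3 * i + 4 /\ 3 * i.+1 + 2 = 3 * i + 5 by lia.
move=> lt_i; rewrite /straight /crossed E1 mirror_right // [in RHS]usedC.
have := mirror_ge i.+1; rewrite E2 => ge_b.
have lt_b : mirror (3 * i + 5) < N by rewrite mirror_lt; lia.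
apply: (@used_either _ (3 * i + 3)); try lia.
  by rewrite usedC; have /andP[] := used_hub lt_i.
have Ep : (3 * i + 4).-1 = 3 * i.+1 by lia.
have Es : (3 * i + 4).+1 = 3 * i + 5 by lia.
move=> w _ /gadget_neighbour; rewrite mirror_left // Ep Es mirror_hub.
by clear; lia.
Qed.

Lemma all_or_none (i : nat) :
  i < m -> straight i = straight 0 /\ crossed i = ~~ straight 0.
Proof.
elim: i => [|i IHi] lt_i; first by rewrite straight0 negbK.
have [s_i c_i] := IHi (ltnW lt_i).
by rewrite straightS // crossedS // s_i c_i negbK.
Qed.

End HamiltonianCycle.

Lemma ham_cyclesP (H : {set {set 'I_n}}) :
  (H \in ham_cycles graph) <->
  exists c : seq 'I_n,
    [/\ uniq c, size c = n, cycle (@sedge graph) c & H = cycle_edges c].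
Proof.
split=> [/imsetP[c]|[c [Uc sz_c cyc_c ->]]].
  by rewrite inE => /and3P[_ Uc cyc_c] ->; exists c; split=> //; rewrite size_tuple card_ord.
have sz : size c == #|graph| by rewrite sz_c card_ord.
apply/imsetP; exists (Tuple sz) => //.
by rewrite inE /= card_ord Uc cyc_c !andbT /n; lia.
Qed.

(** * The two Hamiltonian cycles *)

Definition enumeration (f : nat -> nat) : seq 'I_n := [seq V (f i) | i <- iota 0 n].

Lemma adjacent_succ (i : nat) : i.+1 < n -> adjacent i i.+1.
Proof.
move=> lt_i; rewrite /adjacent /gadget /consecutive eqxx.
by case: (ltnP i.+1 N) => ? /=; rewrite /apex; lia.
Qed.

(** The last vertex is an apex, its label [N + 2r] having the parity of [N]. *)
Lemma adjacent_wrap : adjacent n.-1 0.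
Proof. by rewrite /adjacent /apex /n; lia. Qed.

Lemma path_iota (e : rel nat) (a k : nat) :
  (forall i, a <= i < a + k -> e i i.+1) -> path e a (iota a.+1 k).
Proof.
elim: k a => [|k IHk] a e_succ //=.
by rewrite e_succ ?IHk //= => [i lt_i|]; [apply: e_succ|]; lia.
Qed.

(* Used for the identity and for [mirror]. *)
Section Enumeration.
Variable f : nat -> nat.
Hypothesis f_lt : forall i, (f i < n) = (i < n).
Hypothesis fK : involutive f.
Hypothesis f_adj : forall i j, adjacent (f i) (f j) = adjacent i j.

Lemma enumeration_uniq : uniq (enumeration f).
Proof.
rewrite map_inj_in_uniq ?iota_uniq // => i j.
rewrite !mem_iota !add0n => /= lt_i lt_j /(congr1 val).
by rewrite /= !V_K ?f_lt // => /(can_inj fK).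
Qed.

Lemma enumeration_size : size (enumeration f) = n.
Proof. by rewrite size_map size_iota. Qed.

Lemma enumeration_cycle : cycle (@sedge graph) (enumeration f).
Proof.
suff: path (relpre (V \o f) (@sedge graph)) 0 (rcons (iota 1 (N + r.*2)) 0).
  by rewrite -path_map map_rcons.
have E i j : i < n -> j < n -> relpre (V \o f) (@sedge graph) i j = adjacent i j.
  by move=> lt_i lt_j; rewrite /= !V_K ?f_lt.
rewrite rcons_path; apply/andP; split.
  apply: path_iota => i lt_i.
  by rewrite [_ i i.+1]E ?adjacent_succ // /n; lia.
have -> : last 0 (iota 1 (N + r.*2)) = n.-1.
  by rewrite -nth_last size_iota; case E1: (N + _) => [|p]; rewrite ?nth_iota /n; lia.
by rewrite [_ n.-1 0]E ?adjacent_wrap // /n; lia.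
Qed.

Lemma enumeration_ham : cycle_edges (enumeration f) \in ham_cycles graph.
Proof.
apply/ham_cyclesP; exists (enumeration f).
by rewrite enumeration_uniq enumeration_size enumeration_cycle.
Qed.

Lemma enumeration_edge (i : nat) :
  i.+1 < n -> used (enumeration f) (f i) (f i.+1).
Proof.
move=> lt_i; have lt_i' := ltnW lt_i.
have := @nth_cycle_edges _ (V 0) _ i enumeration_uniq.
by rewrite enumeration_size !(nth_map 0) ?size_iota // !nth_iota //; apply.
Qed.

End Enumeration.

(** * The obstruction *)

Definition rails : {set {set 'I_n}} :=
  [set [set V (3 * i + 1); V (3 * i + 2)] | i : 'I_m].

Lemma card_rails : #|rails| = m.
Proof.
rewrite card_imset ?card_ord // => i j /set2_eqP E; apply: val_inj => /=.
have lt_n (l : 'I_m) d : d <= 2 -> 3 * l + d < n by have := ltn_ord l; rewrite /n; lia.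
by case: E => -[/(congr1 val) + _]; rewrite /= !V_K ?lt_n //; lia.
Qed.

Lemma rails_dichotomy (c : seq 'I_n) :
  uniq c -> size c = n -> cycle (@sedge graph) c ->
  if straight c 0 then rails \subset cycle_edges c
  else [disjoint rails & cycle_edges c].
Proof.
move=> Uc sz_c cyc_c.
have rail (i : 'I_m) := proj1 (all_or_none Uc sz_c cyc_c (ltn_ord i)).
case: ifP rail => s0 rail.
  by apply/subsetP => _ /imsetP[i _ ->]; apply: rail.
rewrite disjoint_subset; apply/subsetP => _ /imsetP[i _ ->].
by rewrite inE; apply/negbT; apply: rail.
Qed.

(** Losing one rail means losing all [m] of them in the same switch, which
removes at most [k < m] edges. *)
Lemma switch_rails (k : nat) (H H' : {set {set 'I_n}}) :
  k < m -> H' \in ham_cycles graph -> kswitch k H H' ->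
  rails \subset H -> rails \subset H'.
Proof.
move=> lt_km /ham_cyclesP[c [Uc sz_c cyc_c EH']] /existsP[j sw] sub_H.
have := rails_dichotomy Uc sz_c cyc_c; rewrite -EH'; case: ifP => // _ dis.
case/existsP: sw => R /existsP[A /and5P[_ /eqP card_R _ _ /eqP EHR]].
have /subset_leq_card : rails \subset R.
  apply/subsetP => e e_rail; have := disjointFr dis e_rail.
  by rewrite EHR !inE (subsetP sub_H _ e_rail) andbT => /norP[/negPn].
by rewrite card_rails card_R; have := ltn_ord j; lia.
Qed.

Lemma not_irreducible (k : nat) : k < m -> ~ switch_irreducible k graph.
Proof.
move=> lt_km irr.
have mirror_ltn i : (mirror i < n) = (i < n) by apply: mirror_lt; rewrite /n; lia.
have id_ltn i : (id i < n) = (i < n) by [].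
have idK : involutive (@id nat) by [].
have id_adj i j : adjacent (id i) (id j) = adjacent i j by [].
have [Z [subZ pathZ lastZ]] := irr _ _ (enumeration_ham id_ltn idK id_adj)
  (enumeration_ham mirror_ltn mirrorK adjacent_mirror).
have n2 : 2 < n by rewrite /n; lia.
have S0 : rails \subset cycle_edges (enumeration id).
  have := rails_dichotomy (enumeration_uniq id_ltn idK) (enumeration_size id)
    (enumeration_cycle id_ltn id_adj).
  by rewrite /straight (enumeration_edge id_ltn idK n2).
(* The mirror image of the edge [{1, 2}] is used, and it excludes the first
   rail. *)
have nS1 : ~~ (rails \subset cycle_edges (enumeration mirror)).
  have := straight0 (enumeration_uniq mirror_ltn mirrorK)
    (enumeration_size mirror) (enumeration_cycle mirror_ltn adjacent_mirror).
  rewrite /crossed (enumeration_edge mirror_ltn mirrorK n2); apply: contraFN.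
  move/subsetP; apply.
  by apply/imsetP; exists (Ordinal (ltnW m_gt1)).
move: nS1; rewrite -lastZ => /negP; apply.
elim: Z (cycle_edges _) S0 pathZ subZ {lastZ} => //= H' Z IHZ H S0 /andP[sw pathZ] subZ.
apply: IHZ => //; last by move=> X XZ; apply: subZ; rewrite inE XZ orbT.
by apply: switch_rails sw S0 => //; apply: subZ; rewrite inE eqxx.
Qed.

End Graph.

Local Open Scope ring_scope.

Theorem mainTheorem3 (k n : nat) (hk : (2 <= k)%N) (hn : (3 * k + 5 <= n)%N) :
  exists G : sgraph,
    [/\ #|G| = n,
        (n%:R - 3 * k%:R - 4) / 2 <= (min_degree G)%:R :> rat
      & ~ switch_irreducible k G].
Proof.
(* The path has [3k+4] or [3k+5] vertices, whichever leaves an odd number of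
   vertices for the alternation of apexes and isolated vertices. *)
pose q := (n - (3 * k + 5))%N; pose r := q./2.
pose N := (3 * k.+1 + 1 + odd q)%N.
have En : n = (N + r.*2).+1 by rewrite /N /r /q; lia.
have m_gt1 : (1 < k.+1)%N by lia.
have N_gt : (3 * k.+1 < N)%N by rewrite /N; lia.
exists (graph k.+1 N r); split.
- by rewrite card_ord.
- have := min_degree_graph r m_gt1 N_gt.
  move: (min_degree _) => d le_d.
  have : n%:R <= 2 * d%:R + 3 * k%:R + 4 :> rat.
    by rewrite -!natrM -!natrD ler_nat En /N; lia.
  by lra.
- exact: not_irreducible.
Qed.
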